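(* Let $L$ be a nonempty set equipped with a metric $d_L\colon L\times L\to[0,1]$, let $\mathcal{M}=(S,A,\tau,\rho,\ell)$ be an $L$-labelled continuous-time Markov chain, and let $\lambda\in(0,1)$. Then $\delta_\lambda$ is a pseudometric on $S$. Moreover, for all $s,t\in S$, $s\sim t$ if and only if $\delta_\lambda(s,t)=0$.
   Context: An $L$-labelled CTMC is a tuple $\mathcal{M}=(S,A,\tau,\rho,\ell)$: $S$ nonempty finite set of states, $A\subseteq S$ absorbing states, $\tau\colon S\setminus A\to\mathcal{D}(S)$ transition probability function, $\rho\colon S\setminus A\to\mathbb{R}_{>0}$ exit rates, $\ell\colon S\to L$ labelling. For $E\subseteq S$, $s\equiv_E t$ means $s,t\in E$ or $s,t\notin E$. $\mathsf{exp}[r]$ is the exponential distribution of rate $r$ on $\mathbb{R}$; $\|\mu-\nu\|_{TV}=\sup_E|\mu(E)-\nu(E)|$ over Borel sets. $\Omega(\mu,\nu)$ is the set of couplings (joint distributions on $S\times S$ with marginals $\mu,\nu$); $\mathcal{K}_d(\mu,\nu)=\min_{\omega\in\Omega(\mu,\nu)}\sum_{u,v}d(u,v)\omega(u,v)$. With $\alpha(s,t)=\|\mathsf{exp}[\rho(s)]-\mathsf{exp}[\rho(t)]\|_{TV}$, $\beta(s,t)=d_L(\ell(s),\ell(t))$, $\mathcal{T}(d)(s,t)=\alpha(s,t)+(1-\alpha(s,t))\mathcal{K}_d(\tau(s),\tau(t))$, the operator $\Delta_\lambda$ on $[0,1]^{S\times S}$ is $\Delta_\lambda(d)(s,t)=1$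 if $s\not\equiv_A t$; $\beta(s,t)$ if $s,t\in A$; $\max\{\beta(s,t),\lambda\mathcal{T}(d)(s,t)\}$ if $s,t\notin A$. $\delta_\lambda$ is the least fixed point of $\Delta_\lambda$ w.r.t. the pointwise order. A stochastic bisimulation on $\mathcal{M}$ is an equivalence relation $R\subseteq S\times S$ such that whenever $s\,R\,t$: (i) $s\equiv_A t$ and $\ell(s)=\ell(t)$, and (ii) if $s,t\notin A$ then $\rho(s)=\rho(t)$ and $\tau(s)(C)=\tau(t)(C)$ for every equivalence class $C\in S/R$. States $s,t$ are bisimilar, $s\sim t$, if some stochastic bisimulation relates them. *)

(* Defs.v *)
From HB Require Import structures.
From mathcomp Require Import all_boot all_order all_algebra.
From mathcomp Require Import all_classical all_reals all_analysis.
From mathcomp Require Import measurable_realfun lra.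
Import Order.TTheory GRing.Theory Num.Theory.
Import numFieldNormedType.Exports.

Set Implicit Arguments.
Unset Strict Implicit.
Unset Printing Implicit Defensive.

Local Open Scope classical_set_scope.
Local Open Scope ring_scope.

Definition is_distribution (R : realType) (S : finType) (mu : S -> R) : Prop :=
  (forall s, 0 <= mu s) /\ \sum_s mu s = 1.

Definition coupling (R : realType) (S : finType) (mu nu : S -> R) :
    set (S * S -> R) :=
  [set w | [/\ is_distribution w,
               forall u, \sum_v w (u, v) = mu u &
               forall v, \sum_u w (u, v) = nu v]].

(* The infimum is a minimum when mu and nu are distributions: see
   [kantorovich_attained]. *)
Definition kantorovich (R : realType) (S : finType) (d : S -> S -> R)
    (mu nu : S -> R) : R :=
  inf [set \sum_u \sum_v d u v * w (u, v) | w in coupling mu nu].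

(* The supremum ranges over the Borel sets of R; mu and nu are meant to be
   finite measures. *)
Definition total_variation (R : realType) (mu nu : set R -> \bar R) : R :=
  sup [set `|fine (mu E) - fine (nu E)| |
       E in (@measurable _ (measurableTypeR R) : set (set R))].

Record ctmc (R : realType) (L : Type) := CTMC {
  state : finType;
  state_nonempty : (0 < #|state|)%N;
  absorbing : {set state};
  trans : {s : state | s \notin absorbing} -> state -> R;
  trans_distribution : forall s, is_distribution (trans s);
  rate : {s : state | s \notin absorbing} -> R;
  rate_gt0 : forall s, 0 < rate s;
  label : state -> L
}.
Arguments absorbing {R L} M : rename.
Arguments trans {R L} M : rename.
Arguments rate {R L} M : rename.
Arguments label {R L} M : rename.

Definition nonabsorbing (R : realType) (L : Type) (M : ctmc R L) :=
  {s : state M | s \notin absorbing M}.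

Section Bisimulation.
Context (R : realType) (L : Type) (M : ctmc R L).

Definition stochastic_bisimulation (r : rel (state M)) : Prop :=
  [/\ equivalence_rel r,
      forall s t, r s t ->
        (s \in absorbing M) = (t \in absorbing M) /\ label M s = label M t &
      forall s t : nonabsorbing M, r (val s) (val t) ->
        rate M s = rate M t /\
        forall C : {set state M}, C \in equivalence_partition r [set: state M] ->
          \sum_(u in C) trans M s u = \sum_(u in C) trans M t u].

Definition bisimilar (s t : state M) : Prop :=
  exists2 r, stochastic_bisimulation r & r s t.

End Bisimulation.

Section BisimilarityDistance.
Context (R : realType) (L : metricType R) (M : ctmc R L).
Implicit Types d : state M -> state M -> R.

Definition alpha (s t : nonabsorbing M) : R :=
  total_variation (exponential_prob (rate M s)) (exponential_prob (rate M t)).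

Definition beta (s t : state M) : R := mdist (label M s) (label M t).

Definition calT d (s t : nonabsorbing M) : R :=
  alpha s t + (1 - alpha s t) * kantorovich d (trans M s) (trans M t).

(* [insub s] is [None] when s is absorbing, and otherwise [Some s'] with s' the
   state s seen as a nonabsorbing one. *)
Definition Delta (lambda : R) d : state M -> state M -> R := fun s t =>
  match insub s : option (nonabsorbing M), insub t : option (nonabsorbing M) with
  | None, None => beta s t
  | Some s', Some t' => Num.max (beta s t) (lambda * calT d s' t')
  | _, _ => 1
  end.

Definition unit_valued d : Prop := forall s t, 0 <= d s t <= 1.

Definition least_fixpoint (F : (state M -> state M -> R) ->
    (state M -> state M -> R)) : set (state M -> state M -> R) :=
  [set d | [/\ unit_valued d, F d = d &
     forall d', unit_valued d' -> F d' = d' -> forall s t, d s t <= d' s t]].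

(* [Delta lambda] has exactly one least fixed point when [lambda] and the
   distances of L are in [0, 1], so the default value of [xget] is then never
   used: see [deltaP]. *)
Definition delta (lambda : R) : state M -> state M -> R :=
  xget (fun _ _ => 0) (least_fixpoint (Delta lambda)).

End BisimilarityDistance.
Arguments delta {R L} M lambda.

Definition is_pseudometric (R : realType) (T : Type) (d : T -> T -> R) : Prop :=
  [/\ forall x y, 0 <= d x y,
      forall x, d x x = 0,
      forall x y, d x y = d y x &
      forall x y z, d x z <= d x y + d y z].

Section Attained.
Context (R : realType) (S : finType).
Implicit Types (mu nu : S -> R) (d : S -> S -> R).

Lemma coupling_nonempty mu nu : is_distribution mu -> is_distribution nu ->
  coupling mu nu !=set0.
Proof.
move=> [mu0 mu1] [nu0 nu1].
have E1 u : \sum_v mu u * nu v = mu u by rewrite -mulr_sumr nu1 mulr1.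
exists (fun p => mu p.1 * nu p.2); split => //=.
- split=> [p|]; first by rewrite mulr_ge0.
  by rewrite -(pair_bigA _ (fun u v => mu u * nu v))/= (eq_bigr _ (fun u _ => E1 u)).
- by move=> v; rewrite -mulr_suml mu1 mul1r.
Qed.


Let cost d (w : S * S -> R) : R := \sum_u \sum_v d u v * w (u, v).

Lemma kantorovich_attained d mu nu :
  is_distribution mu -> is_distribution nu ->
  exists2 w, coupling mu nu w &
    kantorovich d mu nu = cost d w /\
    forall w', coupling mu nu w' -> cost d w <= cost d w'.
Proof.
move=> mud nud.
pose FT := prod_topology (fun _ : S * S => (R : topologicalType)).
have sumc (I : finType) (F : I -> FT -> R) :
    (forall i, continuous (F i)) -> continuous (fun w => \sum_i F i w).
  move=> cF; apply: continuous_big => [|i _]; last exact: cF.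
  exact: add_continuous.
have evc p : continuous (fun w : FT => w p : R) by exact: proj_continuous.
have costc : continuous (cost d : FT -> R).
  apply: (sumc) => u; apply: (sumc) => v w.
  apply: (@continuousM R FT (fun=> d u v) (fun w => w (u, v))); last exact: evc.
  exact: cst_continuous.
have cptC : compact (coupling mu nu : set FT).
  have cptB : compact [set w : FT | forall p, `[0, 1]%classic (w p : R)].
    apply: (@tychonoff (S * S)%type (fun=> R : topologicalType)
      (fun=> `[0, 1]%classic)) => _.
    exact: segment_compact.
  apply: subclosed_compact cptB _; last first.
    move=> w [[w0 w1] _ _] p /=; rewrite in_itv/= w0/= -w1 (bigD1 p)//= lerDl.
    exact: sumr_ge0.
  have -> : (coupling mu nu : set FT) =
      (\bigcap_p [set w : FT | 0 <= (w p : R)]) `&`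
      [set w : FT | \sum_p (w p : R) = 1] `&`
      (\bigcap_u [set w : FT | \sum_v (w (u, v) : R) = mu u]) `&`
      (\bigcap_v [set w : FT | \sum_u (w (u, v) : R) = nu v]).
    apply/seteqP; split => [w [[w0 w1] wl wr]|w [[[w0 w1] wl] wr]].
      by do 3?[split] => // ? _; [exact: w0|exact: wl|exact: wr].
    by split; [split=> // p; exact: w0|move=> u; exact: wl|move=> v; exact: wr].
  have ceq (f : FT -> R) c : continuous f -> closed [set w | f w = c].
    by move=> cf; apply: (@preimage_closed _ _ f [set x | x = c]);
       [move=> *; exact: cf|exact: closed_eq].
  apply: closedI; first apply: closedI; first apply: closedI.
  - apply: closed_bigI => p _.
    by apply: (@preimage_closed _ _ (fun w : FT => w p : R) [set x | 0 <= x]);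
       [move=> *; exact: evc|exact: closed_ge].
  - by apply: ceq; exact: sumc.
  - by apply: closed_bigI => u _; apply: ceq; exact: sumc.
  - by apply: closed_bigI => u _; apply: ceq; exact: sumc.
have [w wC wmin] := @compact_EVT_min FT R (cost d) _
  (coupling_nonempty mud nud) cptC (continuous_subspaceT costc).
rewrite inE in wC.
have wmin' w' : coupling mu nu w' -> cost d w <= cost d w'.
  by move=> w'C; apply: wmin; rewrite inE.
exists w => //; split=> //; apply/eqP; rewrite eq_le; apply/andP; split.
- by apply: ge_inf; [exists (cost d w) => _ [w' ? <-]; exact: wmin'|exists w].
- by apply: lb_le_inf; [exists (cost d w); exists w|move=> _ [w' ? <-]; exact: wmin'].
Qed.

Lemma le_kantorovich d d' mu nu : is_distribution mu -> is_distribution nu ->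
  (forall u v, d u v <= d' u v) -> kantorovich d mu nu <= kantorovich d' mu nu.
Proof.
move=> mud nud dd'.
have [w _ [-> wmin]] := kantorovich_attained d mud nud.
have [w' w'C [-> _]] := kantorovich_attained d' mud nud.
apply: le_trans (wmin _ w'C) _.
by do 2 apply: ler_sum => ? _; apply: ler_wpM2r => //; have [[]] := w'C.
Qed.

Lemma kantorovich_unit d mu nu : is_distribution mu -> is_distribution nu ->
  (forall u v, 0 <= d u v <= 1) -> 0 <= kantorovich d mu nu <= 1.
Proof.
move=> mud nud d01.
have [w [[w0 w1] _ _] [-> _]] := kantorovich_attained d mud nud.
apply/andP; split.
  apply: sumr_ge0 => u _; apply: sumr_ge0 => v _; rewrite mulr_ge0//.
  by have /andP[] := d01 u v.
have -> : 1 = \sum_u \sum_v w (u, v).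
  by rewrite -w1 pair_bigA; apply: eq_bigr => -[].
by apply: ler_sum => u _; apply: ler_sum => v _; rewrite ler_piMl//;
  have /andP[] := d01 u v.
Qed.

End Attained.

Lemma total_variation_unit (R : realType) (P Q : set R -> \bar R) :
  P set0 = 0%E -> Q set0 = 0%E ->
  (forall E, @measurable _ (measurableTypeR R) E -> (0 <= P E <= 1)%E) ->
  (forall E, @measurable _ (measurableTypeR R) E -> (0 <= Q E <= 1)%E) ->
  0 <= total_variation P Q <= 1.
Proof.
move=> P0 Q0 P01 Q01.
set X := [set `|fine (P E) - fine (Q E)| |
  E in (@measurable _ (measurableTypeR R) : set (set R))].
have ub : ubound X 1.
  move=> _ [E mE <-]; rewrite ler_norml.
  have /andP[p0 p1] := P01 E mE; have /andP[q0 q1] := Q01 E mE.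
  have fin (x : \bar R) : (0 <= x)%E -> (x <= 1)%E -> x \is a fin_num.
    by move=> x0 x1; rewrite ge0_fin_numE// (le_lt_trans x1)// ltry.
  have pE := fin _ p0 p1; have qE := fin _ q0 q1.
  move: p0 p1 q0 q1; rewrite -(fineK pE) -(fineK qE) !lee_fin/= => *.
  by apply/andP; split; lra.
have X0 : X 0 by exists set0 => //; rewrite P0 Q0 subrr normr0.
apply/andP; split; first by apply: ub_le_sup => //; exists 1.
by apply: ge_sup => //; exists 0.
Qed.

Section DeltaFixpoint.
Context (R : realType) (L : metricType R) (M : ctmc R L).
Hypothesis mdist_unit : forall x y : L, 0 <= mdist x y <= 1.

Lemma alpha_unit (s t : nonabsorbing M) : 0 <= alpha s t <= 1.
Proof.
have H r : 0 < r -> exponential_prob r set0 = 0%E /\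
    forall E, @measurable _ (measurableTypeR R) E ->
      (0 <= exponential_prob r E <= 1)%E.
  move=> r0; split=> [|E mE]; first by rewrite /exponential_prob integral_set0.
  apply/andP; split.
    by apply: integral_ge0 => x _; rewrite lee_fin exponential_pdf_ge0// ltW.
  rewrite -(integral_exponential_pdf r0); apply: ge0_subset_integral => //=.
  - by apply/measurable_EFinP; exact: measurable_exponential_pdf.
  - by move=> x _; rewrite lee_fin exponential_pdf_ge0// ltW.
have [s0 sE] := H _ (rate_gt0 s); have [t0 tE] := H _ (rate_gt0 t).
exact: total_variation_unit.
Qed.

Context (lambda : R) (lambda_unit : 0 <= lambda <= 1).

Lemma Delta_unit (d : state M -> state M -> R) :
  unit_valued d -> unit_valued (Delta lambda d).
Proof.
move=> d01 s t; rewrite /Delta; case: insub => [s'|]; case: insub => [t'|];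
  rewrite ?ler01 ?lexx//; last exact: mdist_unit.
have /andP[b0 b1] := mdist_unit (label M s) (label M t).
have /andP[a0 a1] := alpha_unit s' t'.
have /andP[k0 k1] :=
  kantorovich_unit (trans_distribution s') (trans_distribution t') d01.
have /andP[l0 l1] := lambda_unit.
rewrite le_max b0/= ge_max b1/= mulr_ile1// /calT; last by nra.
by rewrite addr_ge0// mulr_ge0// subr_ge0.
Qed.

Lemma le_Delta (d d' : state M -> state M -> R) :
  (forall s t, d s t <= d' s t) ->
  forall s t, Delta lambda d s t <= Delta lambda d' s t.
Proof.
move=> dd' s t; rewrite /Delta; case: insub => [s'|]; case: insub => [t'|]//.
rewrite ge_max le_max lexx/= le_max; apply/orP; right.
have /andP[l0 l1] := lambda_unit; apply: ler_wpM2l => //.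
rewrite lerD2l ler_wpM2l//; last by apply: le_kantorovich => //; exact: trans_distribution.
by rewrite subr_ge0; have /andP[] := alpha_unit s' t'.
Qed.

Lemma deltaP : least_fixpoint (@Delta R L M lambda) (delta M lambda).
Proof.
pose D : set (state M -> state M -> R) := [set d | unit_valued d /\
  forall s t, Delta lambda d s t <= d s t].
pose d0 s t := inf [set d s t | d in D].
have D1 : D (fun _ _ => 1).
  have u1 : unit_valued (fun _ _ : state M => 1 : R).
    by move=> s t; rewrite ler01 lexx.
  by split=> // s t; have /andP[] := Delta_unit u1 s t.
have lb s t : lbound [set d s t | d in D] 0.
  by move=> _ [d [d01 _] <-]; have /andP[] := d01 s t.
have le0 d s t : D d -> d0 s t <= d s t.
  by move=> Dd; apply: ge_inf; [exists 0; exact: lb|exists d].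
have ge0 s t x : (forall d, D d -> x <= d s t) -> x <= d0 s t.
  move=> xd; apply: lb_le_inf; first by exists 1; exists (fun _ _ => 1).
  by move=> _ [d Dd <-]; exact: xd.
have d0u : unit_valued d0.
  move=> s t; rewrite (le0 (fun _ _ => 1))// andbT.
  by apply: ge0 => d [d01 _]; have /andP[] := d01 s t.
have Dd0 s t : Delta lambda d0 s t <= d0 s t.
  apply: ge0 => d Dd; have [_ Dd'] := Dd; apply: (le_trans _ (Dd' s t)).
  by apply: le_Delta => s' t'; exact: le0.
apply: (@xgetPex _ _ (least_fixpoint (Delta lambda))).
exists d0; split=> //; last first.
  by move=> d du dE s t; apply: le0; split=> // s' t'; rewrite dE.
apply/funext => s; apply/funext => t; apply/eqP; rewrite eq_le Dd0/=.
by apply: le0; split; [exact: Delta_unit|exact: le_Delta].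
Qed.

End DeltaFixpoint.

(* Main.v *)
(** Since [lambda < 1], [Delta lambda] is a [lambda]-contraction for the sup
norm, so its fixed point [delta] lies below every prefixed point. Symmetry and
[bisimilar s t -> delta s t = 0] follow by exhibiting prefixed points: the
transpose of [delta], and the indicator of the complement of a bisimulation,
whose Kantorovich lifting vanishes by coupling independently inside each class.
For the triangle inequality, gluing optimal couplings shows that an excess of at
most [c] in [delta] is at most [lambda * c], hence at most 0. Conversely,
[delta = 0] is a bisimulation: total variation separates exponential rates, and
an optimal coupling of cost 0 is supported inside the classes. *)
Require Import Defs.
From mathcomp Require Import all_boot all_order all_algebra.
From mathcomp Require Import all_classical all_reals all_analysis.
From mathcomp Require Import measurable_realfun lra.
Local Open Scope ring_scope.

Set Implicit Arguments.
Unset Strict Implicit.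
Unset Printing Implicit Defensive.
Import Order.TTheory GRing.Theory Num.Theory.

(** * Total variation distance and exponential distributions *)

Section TotalVariation.
Context (R : realType).
Local Notation borel := (@measurable _ (measurableTypeR R)).
Local Notation total_variation := Defs.total_variation.
Implicit Types P Q : set R -> \bar R.

(** This bound keeps the differences in [total_variation] bounded above, so that its [sup] is a
    genuine supremum rather than a default value. *)
Definition subprobability_valued P : Prop :=
  forall E, borel E -> (0 <= P E <= 1)%E.

Lemma total_variation_ge P Q E :
  subprobability_valued P -> subprobability_valued Q -> borel E ->
  `|fine (P E) - fine (Q E)| <= total_variation P Q.
Proof.
move=> P01 Q01 mE; apply: ub_le_sup; last by exists E.
have fine01 (x : \bar R) : (0 <= x <= 1)%E -> 0 <= fine x <= 1.
  by case: x => [x||] /andP[]//; rewrite !lee_fin => /= -> ->.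
exists 1 => _ [F mF <-].
have /andP[p0 p1] := fine01 _ (P01 F mF).
have /andP[q0 q1] := fine01 _ (Q01 F mF).
by rewrite ler_norml; apply/andP; split; lra.
Qed.

Lemma total_variation_le P Q c :
  (forall E, borel E -> `|fine (P E) - fine (Q E)| <= c) ->
  total_variation P Q <= c.
Proof.
move=> PQc; apply: ge_sup; last by move=> _ [E mE <-]; exact: PQc.
by exists `|fine (P set0) - fine (Q set0)|, set0.
Qed.

Lemma total_variationC P Q : total_variation P Q = total_variation Q P.
Proof.
rewrite /total_variation; congr sup; apply/seteqP.
by split=> _ [E mE <-]; exists E => //; rewrite distrC.
Qed.

Lemma total_variation_triangle P Q U :
  subprobability_valued P -> subprobability_valued Q ->
  subprobability_valued U ->
  total_variation P U <= total_variation P Q + total_variation Q U.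
Proof.
move=> P01 Q01 U01; apply: total_variation_le => E mE.
apply: le_trans (ler_distD (fine (Q E)) _ _) _.
by rewrite lerD// total_variation_ge.
Qed.

Lemma exponential_prob_subprobability (r : R) :
  0 < r -> subprobability_valued (exponential_prob r).
Proof.
move=> r0 E mE; apply/andP; split.
  by apply: integral_ge0 => x _; rewrite lee_fin exponential_pdf_ge0// ltW.
rewrite -(integral_exponential_pdf r0); apply: ge0_subset_integral => //=.
- by apply/measurable_EFinP; exact: measurable_exponential_pdf.
- by move=> x _; rewrite lee_fin exponential_pdf_ge0// ltW.
Qed.

(** A single test set suffices: [[0, 1]] has mass [1 - exp(-r)], which determines [r]. *)
Lemma total_variation_exponential_eq0 (r q : R) : 0 < r -> 0 < q ->
  total_variation (exponential_prob r) (exponential_prob q) = 0 -> r = q.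
Proof.
move=> r0 q0 tv0.
have mE : borel `[0%R, 1%R]%classic by exact: measurable_itv.
have := total_variation_ge (exponential_prob_subprobability r0)
  (exponential_prob_subprobability q0) mE.
rewrite tv0 normr_le0 !exponential_prob_itv0c// !mulr1 -!EFinB/=.
rewrite subr_eq0 => /eqP/addrI/oppr_inj/expR_inj/oppr_inj; exact.
Qed.

End TotalVariation.

(** * Couplings, gluing and the Kantorovich lifting *)

Section Kantorovich.
Context (R : realType) (S : finType).
Implicit Types (mu nu xi : S -> R) (d : S -> S -> R) (w : S * S -> R).

Lemma is_couplingP mu nu w : is_distribution mu ->
  (forall p, 0 <= w p) -> (forall u, \sum_v w (u, v) = mu u) ->
  (forall v, \sum_u w (u, v) = nu v) -> coupling mu nu w.
Proof.
move=> [_ mu1] w0 wl wr; split=> //; split=> //.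
rewrite -mu1 -(eq_bigr _ (fun u _ => wl u)) pair_bigA.
by apply: eq_bigr => -[].
Qed.

Lemma coupling_le_l mu nu w u v : coupling mu nu w -> w (u, v) <= mu u.
Proof.
by move=> [[w0 _] <- _]; rewrite (bigD1 v)//= lerDl sumr_ge0.
Qed.

Lemma coupling_le_r mu nu w u v : coupling mu nu w -> w (u, v) <= nu v.
Proof.
by move=> [[w0 _] _ <-]; rewrite (bigD1 u)//= lerDl sumr_ge0.
Qed.

Lemma coupling_swap mu nu w :
  coupling mu nu w -> coupling nu mu (fun p => w (p.2, p.1)).
Proof.
move=> [[w0 w1] wl wr]; split=> //=; split=> [p|]; first exact: w0.
rewrite -w1 -(pair_bigA _ (fun u v => w (v, u)))/= exchange_big pair_bigA.
by apply: eq_bigr => -[].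
Qed.

Lemma kantorovich_le d mu nu w :
  is_distribution mu -> is_distribution nu -> coupling mu nu w ->
  kantorovich d mu nu <= \sum_u \sum_v d u v * w (u, v).
Proof.
by move=> mud nud wC; have [w' _ [-> ->]] := kantorovich_attained d mud nud.
Qed.

Lemma kantorovich_swap d mu nu : is_distribution mu -> is_distribution nu ->
  kantorovich (fun u v => d v u) mu nu <= kantorovich d nu mu.
Proof.
move=> mud nud; have [w wC [-> _]] := kantorovich_attained d nud mud.
apply: le_trans (kantorovich_le _ mud nud (coupling_swap wC)) _ => /=.
by rewrite exchange_big.
Qed.

(** A coupling has total mass 1, so a constant slack in the cost contributes exactly [c]. This makes
    the lifting nonexpansive in the sup norm. *)
Lemma kantorovich_le_add d d' c mu nu :
  is_distribution mu -> is_distribution nu ->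
  (forall u v, d u v <= d' u v + c) ->
  kantorovich d mu nu <= kantorovich d' mu nu + c.
Proof.
move=> mud nud dd'.
have [w wC [-> _]] := kantorovich_attained d' mud nud.
apply: le_trans (kantorovich_le _ mud nud wC) _.
have [[w0 w1] _ _] := wC.
have -> : c = \sum_u \sum_v c * w (u, v).
  rewrite -[LHS]mulr1 -w1 mulr_sumr pair_bigA.
  by apply: eq_bigr => -[].
rewrite -big_split/=; apply: ler_sum => u _.
rewrite -big_split/=; apply: ler_sum => v _.
by rewrite -mulrDl ler_wpM2r.
Qed.

(** The joint law of a triple whose outer components are conditionally independent given the middle
    one. Where [nu] vanishes, division by zero returns 0. *)
Definition glue nu (w w' : S * S -> R) : S * S * S -> R :=
  fun p => w (p.1.1, p.1.2) * w' (p.1.2, p.2) / nu p.1.2.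

Section Glue.
Context mu nu xi (w w' : S * S -> R).
Hypotheses (nud : is_distribution nu).
Hypotheses (wC : coupling mu nu w) (w'C : coupling nu xi w').

Lemma glue_ge0 p : 0 <= glue nu w w' p.
Proof.
have [[w0 _] _ _] := wC; have [[w'0 _] _ _] := w'C; have [nu0 _] := nud.
by rewrite /glue !mulr_ge0// invr_ge0.
Qed.

Lemma glue_marginal12 u v : \sum_x glue nu w w' (u, v, x) = w (u, v).
Proof.
have [[w0 _] _ _] := wC; have [_ w'l _] := w'C.
rewrite /glue/= -mulr_suml -mulr_sumr w'l.
(* When [nu v = 0], [w (u, v) <= nu v] forces [w (u, v) = 0], in agreement with the convention for
   division by zero. *)
have [nuv0|nuv0] := eqVneq (nu v) 0; last by rewrite mulfK.
have := coupling_le_r u v wC; rewrite nuv0 => wuv.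
by rewrite mulr0 mul0r; apply/eqP; rewrite eq_le w0 wuv.
Qed.

Lemma glue_marginal23 v x : \sum_u glue nu w w' (u, v, x) = w' (v, x).
Proof.
have [_ _ wr] := wC; have [[w'0 _] _ _] := w'C.
rewrite /glue/= -mulr_suml -mulr_suml wr.
have [nuv0|nuv0] := eqVneq (nu v) 0; last by rewrite mulrAC divff// mul1r.
have := coupling_le_l v x w'C; rewrite nuv0 => wvx.
by rewrite mul0r mul0r; apply/eqP; rewrite eq_le w'0 wvx.
Qed.

End Glue.

(** Gluing two optimal couplings and forgetting the middle component yields a competitor for the
    outer pair. The slack [c] is there because [delta] is not yet known to satisfy the triangle
    inequality when this is applied to it. *)
Lemma kantorovich_triangle d c mu nu xi : is_distribution mu ->
  is_distribution nu -> is_distribution xi ->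
  (forall u v x, d u x <= d u v + d v x + c) ->
  kantorovich d mu xi <= kantorovich d mu nu + kantorovich d nu xi + c.
Proof.
move=> mud nud xid dc.
have [w wC [-> _]] := kantorovich_attained d mud nud.
have [w' w'C [-> _]] := kantorovich_attained d nud xid.
pose g := glue nu w w'.
have g0 p : 0 <= g p by exact: glue_ge0 wC w'C p.
have g12 u v : \sum_x g (u, v, x) = w (u, v) := glue_marginal12 wC w'C u v.
have g23 v x : \sum_u g (u, v, x) = w' (v, x) := glue_marginal23 wC w'C v x.
have [[_ w1] wl _] := wC; have [_ _ w'r] := w'C.
have g13C : coupling mu xi (fun p => \sum_v g (p.1, v, p.2)).
  apply: is_couplingP => //= [p|u|x]; first exact: sumr_ge0.
  - by rewrite exchange_big/= -wl; apply: eq_bigr => v _; exact: g12.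
  - by rewrite exchange_big/= -w'r; apply: eq_bigr => v _; exact: g23.
apply: le_trans (kantorovich_le _ mud xid g13C) _ => /=.
(* Both costs and the constant [c] become sums over triples weighted by [g], so that the hypothesis
   on [d] applies term by term. *)
have -> : \sum_u \sum_v d u v * w (u, v) =
    \sum_u \sum_x \sum_v d u v * g (u, v, x).
  apply: eq_bigr => u _; rewrite exchange_big/=.
  by apply: eq_bigr => v _; rewrite -g12 mulr_sumr.
have -> : \sum_v \sum_x d v x * w' (v, x) =
    \sum_u \sum_x \sum_v d v x * g (u, v, x).
  under [RHS]eq_bigr do rewrite exchange_big.
  rewrite [RHS]exchange_big/=; apply: eq_bigr => v _.
  rewrite exchange_big/=; apply: eq_bigr => x _.
  by rewrite -g23 mulr_sumr.
have -> : c = \sum_u \sum_x \sum_v c * g (u, v, x).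
  rewrite -[LHS]mulr1 -w1 mulr_sumr.
  under [RHS]eq_bigr do rewrite exchange_big.
  rewrite pair_bigA; apply: eq_bigr => -[u v] _ /=.
  by rewrite -g12 mulr_sumr.
rewrite -!big_split/=; apply: ler_sum => u _.
rewrite -!big_split/=; apply: ler_sum => x _.
rewrite mulr_sumr -!big_split/=; apply: ler_sum => v _.
by rewrite -!mulrDl ler_wpM2r.
Qed.

(** * Zero Kantorovich cost and equality of class masses *)

Context (r : rel S) (r_equiv : equivalence_rel r).

Let rxx x : r x x. Proof. by have [] := r_equiv x x x. Qed.

Let rl x y z : r x y -> r x z = r y z.
Proof. by have [_] := r_equiv x y z; exact. Qed.

Let rC x y : r x y = r y x.
Proof. by apply/idP/idP => /rl <-. Qed.

Lemma kantorovich_lifting_eq0 mu nu :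
  is_distribution mu -> is_distribution nu ->
  (forall u, \sum_(v | r u v) mu v = \sum_(v | r u v) nu v) ->
  kantorovich (fun u v => (~~ r u v)%:R) mu nu <= 0.
Proof.
move=> mud nud munu; have [mu0 _] := mud; have [nu0 _] := nud.
pose m u := \sum_(v | r u v) mu v.
(* Within each class the two conditional distributions are coupled
   independently; a class of mass 0 contributes [x / 0 = 0]. *)
pose w (p : S * S) := if r p.1 p.2 then mu p.1 * nu p.2 / m p.1 else 0.
have m0 u : 0 <= m u by exact: sumr_ge0.
have mr u v : r u v -> m u = m v.
  by move=> ruv; apply: eq_bigl => x; exact: rl.
(* If [m u = 0], the bounds force [f u = 0], so cancellation remains valid. *)
have cancel (f : S -> R) u : 0 <= f u <= m u -> f u * (m u / m u) = f u.
  have [->|mu_n0 _] := eqVneq (m u) 0; last by rewrite divff// mulr1.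
  by rewrite -eq_le mul0r mulr0 => /eqP.
have wC : coupling mu nu w.
  apply: is_couplingP => // [p|u|v]; rewrite /w/=.
  - by case: ifP => // _; rewrite !mulr_ge0// invr_ge0.
  - rewrite -big_mkcond/= -mulr_suml -mulr_sumr -munu -mulrA cancel//.
    by rewrite mu0 /m (bigD1 u)//= lerDl sumr_ge0.
  - rewrite -big_mkcond/=.
    under eq_bigr => u ruv do rewrite (mr u v ruv) -mulrA [nu v / _]mulrC mulrA.
    rewrite -!mulr_suml (eq_bigl (r v)); last by move=> u; rewrite rC.
    rewrite -/(m v) mulrC cancel// nu0/= /m munu.
    by rewrite (bigD1 v)//= lerDl sumr_ge0.
(* The coupling vanishes off [r], and the cost vanishes on [r]. *)
apply: le_trans (kantorovich_le _ mud nud wC) _.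
by apply: sumr_le0 => u _; apply: sumr_le0 => v _; rewrite /w/=;
  case: (r u v); rewrite ?mul0r ?mulr0.
Qed.

(** All terms of an optimal cost equal to 0 vanish, so the coupling charges only pairs lying both
    inside [C] or both outside it. Its mass on [C * S] therefore equals its mass on [S * C]. *)
Lemma kantorovich_eq0_class d mu nu (C : {set S}) :
  is_distribution mu -> is_distribution nu -> (forall u v, 0 <= d u v) ->
  (forall u v, d u v = 0 -> (u \in C) = (v \in C)) ->
  kantorovich d mu nu = 0 -> \sum_(u in C) mu u = \sum_(u in C) nu u.
Proof.
move=> mud nud d0 dC.
have [w [[w0 _] wl wr] [-> _]] := kantorovich_attained d mud nud.
have dw0 u v : 0 <= d u v * w (u, v) by rewrite mulr_ge0.
move=> /psumr_eq0P => /(_ (fun u _ => sumr_ge0 _ (fun v _ => dw0 u v))) sum0.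
have wC u v : w (u, v) != 0 -> (u \in C) = (v \in C).
  move=> wuv; apply: dC; apply/eqP.
  have := psumr_eq0P (fun v _ => dw0 u v) (sum0 u isT) (i := v) isT.
  by move/eqP; rewrite mulf_eq0 (negbTE wuv) orbF.
under eq_bigr do rewrite -wl.
under [RHS]eq_bigr do rewrite -wr.
rewrite big_mkcond [RHS]big_mkcond/=.
have mk (b : bool) (F : S -> R) :
    (if b then \sum_v F v else 0) = \sum_v (if b then F v else 0).
  by case: b; rewrite // big1.
under eq_bigr do rewrite mk.
under [RHS]eq_bigr do rewrite mk.
rewrite [RHS]exchange_big/=; apply: eq_bigr => u _; apply: eq_bigr => v _.
by have [->|/wC ->//] := eqVneq (w (u, v)) 0; rewrite !if_same.
Qed.

End Kantorovich.

(** * Two real inequalities: contraction of an excess, and the probabilistic sum *)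

Lemma contraction_le0 (R : realType) (T : finType) (k : R) (f : T -> R) :
  k < 1 ->
  (forall c, 0 <= c -> (forall t, f t <= c) -> forall t, f t <= k * c) ->
  forall t, f t <= 0.
Proof.
move=> k1 fk.
(* The least nonnegative upper bound of [f]. The hypothesis improves it to [c <= max(0, k * c)],
   which forces [c <= 0] as [k < 1]. *)
pose c := \big[Num.max/0]_t f t.
have c0 : 0 <= c by exact: bigmax_ge_id.
have fc t : f t <= c by exact: le_bigmax.
have c0' : c <= Num.max 0 (k * c).
  apply: bigmax_le => [|t _]; first by rewrite le_max lexx.
  by rewrite le_max fk ?orbT.
move=> t; apply: le_trans (fc t) _.
by move: c0'; rewrite le_max => /orP[//|]; nra.
Qed.

(** The expression [a + (1 - a) * k] is nondecreasing in [a] when [k <= 1], so [a13] can first be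
    replaced by [a12 + a23]. *)
Lemma probabilistic_sum_triangle (R : realFieldType)
    (a12 a23 a13 k12 k23 k13 c : R) :
  0 <= a12 <= 1 -> 0 <= a23 <= 1 ->
  0 <= k12 <= 1 -> 0 <= k23 <= 1 -> 0 <= k13 <= 1 -> 0 <= c ->
  a13 <= a12 + a23 -> k13 <= k12 + k23 + c ->
  a13 + (1 - a13) * k13 <=
    a12 + (1 - a12) * k12 + (a23 + (1 - a23) * k23) + c.
Proof.
move=> /andP[a120 a121] /andP[a230 a231] /andP[k120 k121] /andP[k230 k231].
move=> /andP[k130 k131] c0 a13le k13le.
have step1 : a13 + (1 - a13) * k13 <= a12 + a23 + (1 - a12 - a23) * k13 by nra.
(* If [a12 + a23 > 1], the coefficient of [k13] in [step1] is negative and the right-hand side of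
   the goal is at least [a12 + a23]. Otherwise the bound on [k13] can be substituted, and the
   surplus is the sum of the three products below. *)
have [a_le1|a_gt1] := leP (a12 + a23) 1; last by nra.
have step2 : (1 - a12 - a23) * k13 <= (1 - a12 - a23) * (k12 + k23 + c).
  by apply: ler_wpM2l => //; lra.
have p1 : 0 <= a12 * k23 by rewrite mulr_ge0.
have p2 : 0 <= a23 * k12 by rewrite mulr_ge0.
have p3 : 0 <= (a12 + a23) * c by rewrite mulr_ge0// addr_ge0.
by lra.
Qed.

(** * The lifting [calT] and the operator [Delta] *)

Section Delta.
Context (R : realType) (L : metricType R) (M : ctmc R L).
Hypothesis mdist_unit : forall x y : L, 0 <= mdist x y <= 1.
Implicit Types d : state M -> state M -> R.

Lemma alphaxx (s : nonabsorbing M) : alpha s s = 0.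
Proof.
apply/eqP; rewrite eq_le; have /andP[-> _] := alpha_unit s s; rewrite andbT.
by apply: total_variation_le => E _; rewrite subrr normr0.
Qed.

Lemma alphaC (s t : nonabsorbing M) : alpha s t = alpha t s.
Proof. exact: total_variationC. Qed.

Lemma alpha_triangle (s t u : nonabsorbing M) :
  alpha s u <= alpha s t + alpha t u.
Proof.
by apply: total_variation_triangle; apply: exponential_prob_subprobability;
  exact: rate_gt0.
Qed.

Lemma rate_alpha_eq0 (s t : nonabsorbing M) :
  alpha s t = 0 -> rate M s = rate M t.
Proof. by apply: total_variation_exponential_eq0; exact: rate_gt0. Qed.

Lemma calT_unit d (s t : nonabsorbing M) :
  unit_valued d -> 0 <= calT d s t <= 1.
Proof.
move=> d01; rewrite /calT; have /andP[a0 a1] := alpha_unit s t.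
have /andP[k0 k1] :=
  kantorovich_unit (trans_distribution s) (trans_distribution t) d01.
by apply/andP; split; nra.
Qed.

Lemma calT_le_add d d' c (s t : nonabsorbing M) : 0 <= c ->
  (forall u v, d u v <= d' u v + c) -> calT d s t <= calT d' s t + c.
Proof.
move=> c0 dd'; rewrite /calT; have /andP[a0 a1] := alpha_unit s t.
have := kantorovich_le_add (trans_distribution s) (trans_distribution t) dd'.
by move=> ?; nra.
Qed.

Lemma calT_triangle d c (s t u : nonabsorbing M) :
  0 <= c -> unit_valued d ->
  (forall x y z, d x z <= d x y + d y z + c) ->
  calT d s u <= calT d s t + calT d t u + c.
Proof.
move=> c0 d01 dc; rewrite /calT.
have kantorovich01 (x y : nonabsorbing M) :=
  kantorovich_unit (trans_distribution x) (trans_distribution y) d01.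
apply: probabilistic_sum_triangle => //; try exact: alpha_unit.
- exact: alpha_triangle.
- by apply: kantorovich_triangle => //; exact: trans_distribution.
Qed.

Context (lambda : R) (lambda01 : 0 < lambda < 1).

Let lambda_unit : 0 <= lambda <= 1.
Proof. by have /andP[/ltW -> /ltW ->] := lambda01. Qed.

Lemma Delta_absorbing d s t : s \in absorbing M -> t \in absorbing M ->
  Delta lambda d s t = beta s t.
Proof. by move=> sA tA; rewrite /Delta !insubF//= ?sA ?tA. Qed.

Lemma Delta_nonabsorbing d (s t : nonabsorbing M) :
  Delta lambda d (val s) (val t) =
  Num.max (beta (val s) (val t)) (lambda * calT d s t).
Proof. by rewrite /Delta !valK. Qed.

Lemma Delta_mixed d s t : (s \in absorbing M) != (t \in absorbing M) ->
  Delta lambda d s t = 1.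
Proof.
rewrite /Delta; case: insubP => [s' sA _|/negbNE sA];
  case: insubP => [t' tA _|/negbNE tA] //=; last by rewrite sA tA.
by rewrite (negbTE sA) (negbTE tA).
Qed.

(** Case analysis on this view exposes nonabsorbing states as [val] of subtype elements, the form in
    which [insub] in [Delta] reduces. *)
Variant same_kind_spec : state M -> state M -> Prop :=
| BothAbsorbing s t of s \in absorbing M & t \in absorbing M :
    same_kind_spec s t
| BothNonabsorbing (s t : nonabsorbing M) : same_kind_spec (val s) (val t).

Lemma same_kindP s t : (s \in absorbing M) = (t \in absorbing M) ->
  same_kind_spec s t.
Proof.
case: (boolP (s \in absorbing M)) => sA /esym tA; first by constructor.
exact: (BothNonabsorbing (exist _ s sA) (exist _ t (negbT tA))).
Qed.

(** The contraction property in one-sided form: only the [calT] term depends on [d], and it carries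
    the factor [lambda]. *)
Lemma Delta_le_add d d' c : 0 <= c -> (forall s t, d s t <= d' s t + c) ->
  forall s t, Delta lambda d s t <= Delta lambda d' s t + lambda * c.
Proof.
move=> c0 dd' s t; have /andP[l0 _] := lambda_unit.
have lc0 : 0 <= lambda * c by exact: mulr_ge0.
have [|ne] := eqVneq (s \in absorbing M) (t \in absorbing M); last first.
  by rewrite !Delta_mixed// lerDl.
case/same_kindP => {}s {}t.
  by move=> sA tA; rewrite !Delta_absorbing// lerDl.
rewrite !Delta_nonabsorbing ge_max; apply/andP; split.
  apply: (@le_trans _ _ (beta (val s) (val t) + lambda * c)).
    by rewrite lerDl.
  by rewrite lerD2r le_max lexx.
apply: (@le_trans _ _ (lambda * calT d' s t + lambda * c)); last first.
  by rewrite lerD2r le_max lexx orbT.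
by rewrite -mulrDr ler_wpM2l// calT_le_add.
Qed.

(** * Pseudometric laws and bisimilarity for the fixed point *)

Local Notation delta := (delta M lambda).

Lemma delta_unit : unit_valued delta.
Proof. by have [] := deltaP M mdist_unit lambda_unit. Qed.

Lemma deltaE : Delta lambda delta = delta.
Proof. by have [] := deltaP M mdist_unit lambda_unit. Qed.

(** If [delta] exceeds [d] by at most [c], applying [Delta] to both shrinks the excess to
    [lambda * c]: [delta] is fixed and [d] can only decrease. *)
Lemma delta_le_prefixpoint d :
  (forall s t, Delta lambda d s t <= d s t) -> forall s t, delta s t <= d s t.
Proof.
move=> dpre s t; rewrite -subr_le0; have /andP[_ l1] := lambda01.
apply: (contraction_le0 l1 (f := fun p => delta p.1 p.2 - d p.1 p.2) _ (s, t)).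
move=> c c0 dc [u v] /=; rewrite lerBlDl -deltaE.
apply: le_trans (Delta_le_add (d' := d) c0 _ u v) _; last by rewrite lerD2r.
by move=> x y; rewrite -lerBlDl; exact: (dc (x, y)).
Qed.

Lemma bisimilar_delta0 s t : bisimilar s t -> delta s t = 0.
Proof.
move=> [r [requiv rlab rtrans] rst].
pose d u v : R := (~~ r u v)%:R.
have d01 : unit_valued d.
  by move=> u v; rewrite /d; case: (r u v); rewrite ?lexx ?ler01.
have /(_ s t) : forall u v, delta u v <= d u v; last first.
  rewrite /d rst => le0; apply/eqP; rewrite eq_le le0.
  by have /andP[] := delta_unit s t.
apply: delta_le_prefixpoint => u v.
(* On unrelated pairs [d] is 1, which bounds every value of [Delta]. *)
rewrite {2}/d; case: (boolP (r u v)) => ruv /=; last first.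
  by have /andP[] := Delta_unit mdist_unit lambda_unit d01 u v.
have [kind lab] := rlab u v ruv.
have beta0 : beta u v = 0 by rewrite /beta lab mdistxx.
case/same_kindP: kind ruv beta0 {lab} => {}u {}v; last first.
  move=> ruv beta0; rewrite Delta_nonabsorbing beta0 ge_max lexx/=.
  have [rate_eq cls] := rtrans u v ruv; have /andP[l0 _] := lambda_unit.
  (* It remains to show [calT d u v <= 0]; equal rates make [alpha] vanish, leaving the Kantorovich
     term alone. *)
  rewrite pmulr_rle0; last by have /andP[] := lambda01.
  have -> : calT d u v = kantorovich d (trans M u) (trans M v).
    have alpha0 : alpha u v = 0 by rewrite -(alphaxx u) /alpha rate_eq.
    by rewrite /calT alpha0 add0r subr0 mul1r.
  apply: kantorovich_lifting_eq0 => //; [exact: trans_distribution..|].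
  move=> x.
  have := cls [set y in [set: state M] | r x y] (imset_f _ (finset.in_setT x)).
  by under eq_bigl do rewrite !inE; under [RHS]eq_bigl do rewrite !inE.
by move=> uA vA _ beta0; rewrite Delta_absorbing// beta0.
Qed.

(** Together with [bisimilar_delta0], this makes [delta] vanish on the diagonal. *)
Lemma bisimilar_refl (s : state M) : bisimilar s s.
Proof.
exists (fun x y => x == y); last exact: eqxx.
split=> [x y z|x y /eqP ->//|x y /eqP/val_inj ->//].
by split; [exact: eqxx|move=> /eqP ->].
Qed.

Lemma deltaC s t : delta s t = delta t s.
Proof.
suff le_delta x y : delta x y <= delta y x.
  by apply/eqP; rewrite eq_le !le_delta.
apply: (delta_le_prefixpoint (d := fun x y => delta y x)) => {s t x y} s t /=.
rewrite -[in leRHS]deltaE.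
have [|ne] := eqVneq (s \in absorbing M) (t \in absorbing M); last first.
  by rewrite !Delta_mixed// eq_sym.
case/same_kindP => {}s {}t.
  by move=> sA tA; rewrite !Delta_absorbing// /beta metric_sym.
rewrite !Delta_nonabsorbing /beta metric_sym ge_max le_max lexx/= le_max.
apply/orP; right; have /andP[l0 _] := lambda_unit; rewrite ler_wpM2l//.
rewrite /calT alphaC lerD2l ler_wpM2l//.
  by rewrite subr_ge0; have /andP[] := alpha_unit t s.
by apply: kantorovich_swap; exact: trans_distribution.
Qed.

Lemma beta_le_delta s t : (s \in absorbing M) = (t \in absorbing M) ->
  beta s t <= delta s t.
Proof.
case/same_kindP => {}s {}t; rewrite -deltaE.
  by move=> sA tA; rewrite Delta_absorbing.
by rewrite Delta_nonabsorbing le_max lexx.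
Qed.

Lemma calT_le_delta (s t : nonabsorbing M) :
  lambda * calT delta s t <= delta (val s) (val t).
Proof. by rewrite -[in leRHS]deltaE Delta_nonabsorbing le_max lexx orbT. Qed.

Lemma delta_mixed s t : (s \in absorbing M) != (t \in absorbing M) ->
  delta s t = 1.
Proof. by move=> ne; rewrite -deltaE Delta_mixed. Qed.

Lemma delta_triangle s t u : delta s u <= delta s t + delta t u.
Proof.
rewrite -subr_le0; have /andP[l0 l1] := lambda01.
apply: (contraction_le0 l1 (f := fun p : state M * state M * state M =>
  delta p.1.1 p.2 - (delta p.1.1 p.1.2 + delta p.1.2 p.2)) _ (s, t, u)).
move=> c c0 dc [[x y] z] /=; rewrite lerBlDl {s t u}.
have lc0 : 0 <= lambda * c by rewrite mulr_ge0// ltW.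
have le1 p q : delta p q <= 1 by have /andP[] := delta_unit p q.
have ge0 p q : 0 <= delta p q by have /andP[] := delta_unit p q.
(* A mixed pair on the right contributes 1, which already dominates [delta x z]. *)
have [xy|/delta_mixed ->] := eqVneq (x \in absorbing M) (y \in absorbing M);
  last by have := le1 x z; have := ge0 y z; lra.
have [yz|/delta_mixed ->] := eqVneq (y \in absorbing M) (z \in absorbing M);
  last by have := le1 x z; have := ge0 x y; lra.
have bxy := beta_le_delta xy; have byz := beta_le_delta yz.
have bxz : beta x z <= delta x y + delta y z + lambda * c.
  by have := metric_triangle (label M x) (label M y) (label M z);
     rewrite -!/(beta _ _); lra.
case/same_kindP: xy yz bxz {bxy byz} => {}x {}y.
  move=> xA yA; rewrite yA => /esym zA bxz.
  by rewrite -{1}deltaE Delta_absorbing.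
move=> yz; case: (boolP (z \in absorbing M)) yz => [zA|zA _].
  by rewrite (negbTE (valP y)).
have [z' ->] : exists z' : nonabsorbing M, z = val z' by exists (exist _ z zA).
move=> bxz; rewrite -{1}deltaE Delta_nonabsorbing ge_max bxz/=.
(* The excess [c] between states gives the same excess for [calT], which the factor [lambda] then
   shrinks. *)
have dc' p q r : delta p r <= delta p q + delta q r + c.
  by have := dc (p, q, r); rewrite /= lerBlDl.
have := calT_triangle x y z' c0 delta_unit dc'; rewrite -(ler_pM2l l0) => Txz.
apply: le_trans Txz _.
rewrite [leLHS]mulrDr lerD2r [leLHS]mulrDr.
by apply: lerD; exact: calT_le_delta.
Qed.

Lemma delta0_bisimilar s t : delta s t = 0 -> bisimilar s t.
Proof.
move=> dst; exists (fun x y => delta x y == 0); last by rewrite dst.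
have ge0 p q : 0 <= delta p q by have /andP[] := delta_unit p q.
have deltaxx x : delta x x = 0 by exact/bisimilar_delta0/bisimilar_refl.
have delta0l x y z : delta x y = 0 -> delta x z = delta y z.
  move=> dxy; apply/eqP; rewrite eq_le.
  have := delta_triangle x y z; have := delta_triangle y x z.
  by rewrite (deltaC y x) dxy !add0r => -> ->.
split=> [x y z|x y /eqP dxy|x y /eqP dxy].
- by split; [rewrite deltaxx|move=> /eqP/delta0l ->].
- have [kind|/delta_mixed] := eqVneq (x \in absorbing M) (y \in absorbing M);
    last by rewrite dxy => /esym/eqP; rewrite oner_eq0.
  split=> //; apply: mdist_positivity; apply/eqP; rewrite eq_le mdist_ge0 andbT.
  by rewrite -dxy beta_le_delta.
- have /andP[l0 _] := lambda01.
  have /andP[a0 a1] := alpha_unit x y.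
  have /andP[k0 k1] := kantorovich_unit (trans_distribution x)
    (trans_distribution y) delta_unit.
  (* Here [lambda > 0] matters: it lets [calT] vanish along with [delta]. Both summands of [calT]
     are nonnegative, so first [alpha] and then the Kantorovich term is 0. *)
  have T0 : calT delta x y <= 0.
    by rewrite -(pmulr_rle0 _ l0) -dxy calT_le_delta.
  have alpha0 : alpha x y = 0.
    by apply/eqP; rewrite eq_le a0 andbT; rewrite /calT in T0; nra.
  split; first exact: rate_alpha_eq0.
  move=> _ /imsetP[z _ ->].
  apply: (kantorovich_eq0_class (d := delta)) => //;
    [exact: trans_distribution..| |].
    (* States at distance 0 are equally far from the representative [z], hence belong to its class
       together. *)
    by move=> u v duv; rewrite !inE/= deltaC (delta0l _ _ z duv) deltaC.
  apply/eqP; rewrite eq_le k0 andbT.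
  by move: T0; rewrite /calT alpha0 add0r subr0 mul1r.
Qed.

End Delta.

Theorem theorem1p9 (R : realType) (L : metricType R) (L_nonempty : inhabited L)
    (mdist_unit : forall x y : L, 0 <= mdist x y <= 1)
    (M : ctmc R L) (lambda : R) (lambda01 : 0 < lambda < 1) :
  is_pseudometric (delta M lambda) /\
  forall s t : state M, bisimilar s t <-> delta M lambda s t = 0.
Proof.
split; last first.
  by move=> s t; split; [exact: bisimilar_delta0|exact: delta0_bisimilar].
split.
- by move=> s t; have /andP[] := delta_unit mdist_unit lambda01 s t.
- by move=> s; apply: bisimilar_delta0 => //; exact: bisimilar_refl.
- exact: deltaC.
- by move=> s t u; exact: delta_triangle.
Qed.
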